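(* Let $R$ be a commutative ring and let $S$ be the antipode of the Hopf algebra $\mathtt{NCQSym}$ over $R$. Then for every $n\geq0$ and every composition $\alpha\vDash n$ we have $$S(\mathrm{F}_{\alpha}^{\operatorname{Id}_{n}})=(-1)^{n}\mathrm{F}_{\alpha^{t}}^{w^{0}_{n}}.$$
   Context: Compositions. A composition $\alpha\vDash n$ of an integer $n\geq0$ is a finite sequence $(\alpha_{1},\ldots,\alpha_{\ell})$ of positive integers summing to $n$; $\ell(\alpha)=\ell$, and $\emptyset$ is the only composition of $0$. Put $\mathbb{N}_{n}=\{1,\ldots,n\}$. For $n\geq1$, $\operatorname{comp}_{n}$ is the bijection from subsets of $\mathbb{N}_{n-1}$ to compositions of $n$ that takes $T=\{t_{1}<\cdots<t_{\ell-1}\}$ to the composition whose $j$th entry is $t_{j}-t_{j-1}$, $1\leq j\leq\ell$, where $t_{0}=0$, $t_{\ell}=n$. For compositions $\alpha,\beta$ of the same $n$, $\beta\preceq\alpha$ means that $\beta$ refines $\alpha$, i.e., $\beta$ is the concatenation, in order, of compositions of $\alpha_{1},\ldots,\alpha_{\ell}$. If $\alpha=\operatorname{comp}_{n}T$ then $\alpha^{t}=\operatorname{comp}_{n}\{n-t\;|\;t\in\mathbb{N}_{n-1}\setminus T\}$; also $\emptyset^{t}=\emptyset$. The Hopf algebra $\mathtt{NCQSym}$ (word quasi-symmetric functions). A set composition $\mathbf{A}=(A_{1},\ldots,A_{\ell})\vDash\mathbb{N}_{n}$ is an ordered collection of non-empty pairwise disjoint sets with union $\mathbb{N}_{n}$.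 In the ring of power series over $R$ in non-commuting variables $x_{1},x_{2},\ldots$, for $\mathbf{A}\vDash\mathbb{N}_{n}$ of length $\ell$ and $I=\{i_{1}<\cdots<i_{\ell}\}\subseteq\mathbb{N}$, let $x_{I}^{\mathbf{A}}=x_{\eta_{1}}x_{\eta_{2}}\cdots x_{\eta_{n}}$, where $\eta_{k}=i_{j}$ if $k\in A_{j}$, and set $\mathrm{M}_{\mathbf{A}}=\sum_{|I|=\ell}x_{I}^{\mathbf{A}}$ (with $\mathrm{M}_{\emptyset}=1$). $\mathtt{NCQSym}$ is the free $R$-module with basis $\{\mathrm{M}_{\mathbf{A}}\}$, $\mathbf{A}$ running over set compositions of $\mathbb{N}_{n}$ for all $n\geq0$, graded by $n$; it is closed under the product of power series. Its co-multiplication is $\Delta(\mathrm{M}_{\mathbf{A}})=\sum_{k=0}^{\ell}\mathrm{M}_{\operatorname{st}(A_{1},\ldots,A_{k})}\otimes\mathrm{M}_{\operatorname{st}(A_{k+1},\ldots,A_{\ell})}$, where $\operatorname{st}$ transports a set composition of a finite $X\subseteq\mathbb{N}$ to one of $\mathbb{N}_{|X|}$ via the order-preserving bijection $X\to\mathbb{N}_{|X|}$; the co-unit is the projection onto degree $0$. This is a connected graded bi-algebra, hence a Hopf algebra, whose antipode is the two-sided convolution inverse of the identity. Fundamental elements. For $\alpha\vDash n$ and $\rho\in S_{n}$ (the symmetric group), $\mathbf{A}_{\alpha}^{\rho}\vDash\mathbb{N}_{n}$ is the set composition whose $j$th set is $\{\rho(k)\;|\;\alpha_{1}+\cdots+\alpha_{j-1}<k\leq\alpha_{1}+\cdots+\alpha_{j}\}$.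 Set $\mathrm{M}_{\alpha}^{\rho}=\mathrm{M}_{\mathbf{A}_{\alpha}^{\rho}}$ and $\mathrm{F}_{\alpha}^{\rho}=\sum_{\beta\preceq\alpha}\mathrm{M}_{\beta}^{\rho}$. $\operatorname{Id}_{n}\in S_{n}$ is the identity and $w^{0}_{n}\in S_{n}$ is the longest element, $w^{0}_{n}(i)=n+1-i$. *)

(* Defs.v *)
From HB Require Import structures.
From mathcomp Require Import all_boot all_order all_algebra all_fingroup.
From mathcomp Require Import finmap monalg.

Set Implicit Arguments.
Unset Strict Implicit.
Unset Printing Implicit Defensive.

Import GRing.Theory.

Local Open Scope fset_scope.
Local Open Scope ring_scope.

Structure composition (n : nat) := Composition {
  comp_val :> seq nat;
  comp_valP : (0%N \notin comp_val) && (sumn comp_val == n)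
}.

HB.instance Definition _ n := [isSub for @comp_val n].
HB.instance Definition _ n := [Countable of composition n by <:].

(* Subsets of {1, ..., n-1} are encoded as {set 'I_n.-1}, i standing for i.+1;
   cut_points lists t_1 < ... < t_l = n. *)
Definition cut_points n (T : {set 'I_n.-1}) : seq nat :=
  rcons [seq (val i).+1 | i <- enum T] n.

Definition comp_seq n (T : {set 'I_n.-1}) : seq nat :=
  if n is 0 then [::] else pairmap (fun s t => t - s)%N 0%N (cut_points T).

Lemma cut_points_sorted n (T : {set 'I_n.-1}) :
  (0 < n)%N -> path ltn 0%N (cut_points T).
Proof.
move=> n0; rewrite -[path _ _ _]/(sorted ltn (_ :: _)).
rewrite sorted_pairwise; last exact: ltn_trans.
rewrite /= /cut_points pairwise_rcons all_rcons /= n0 /=.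
apply/and3P; split.
- by apply/allP => _ /mapP[i _ ->].
- apply/allP => _ /mapP[i _ ->] /=.
  by apply: (leq_ltn_trans (ltn_ord i)); rewrite ltn_predL.
rewrite -sorted_pairwise; last exact: ltn_trans.
rewrite sorted_map; have: sorted ltn (map val (enum T)).
  apply: (subseq_sorted ltn_trans (s2 := iota 0 n.-1)).
    by rewrite -val_enum_ord map_subseq // enumT /enum_mem filter_subseq.
  exact: iota_ltn_sorted.
by rewrite sorted_map.
Qed.

Lemma pairmap_subK k s : path ltn k s ->
  scanl addn k (pairmap (fun a b => b - a)%N k s) = s.
Proof.
by elim: s k => //= a s IHs k /andP[/ltnW ka /IHs]; rewrite subnKC // => ->.
Qed.

Lemma pairmap_sub_notin k s : path ltn k s ->
  0%N \notin pairmap (fun a b => b - a)%N k s.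
Proof.
elim: s k => //= a s IHs k /andP[ka /IHs].
by rewrite in_cons negb_or => ->; rewrite eq_sym subn_eq0 -ltnNge ka.
Qed.

Lemma pairmap_sub_sum k s : path ltn k s ->
  (k + sumn (pairmap (fun a b => b - a)%N k s))%N = last k s.
Proof.
elim: s k => [|a s IHs] k //=; first by rewrite addn0.
by case/andP=> /ltnW ka /IHs <-; rewrite addnA subnKC.
Qed.

Fact comp_subproof n (T : {set 'I_n.-1}) :
  (0%N \notin comp_seq T) && (sumn (comp_seq T) == n).
Proof.
case: n T => [|n] T //; have sT := cut_points_sorted T (ltn0Sn n).
rewrite /comp_seq pairmap_sub_notin //=; apply/eqP.
by rewrite -[LHS]add0n pairmap_sub_sum // last_rcons.
Qed.

Definition comp_of_set n (T : {set 'I_n.-1}) : composition n :=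
  Composition (comp_subproof T).

Definition comp_set n (alpha : composition n) : {set 'I_n.-1} :=
  [set i : 'I_n.-1 | i.+1 \in scanl addn 0%N alpha].

Lemma compK n : cancel (@comp_of_set n) (@comp_set n).
Proof.
case: n => [|n] T; apply/setP => i; first by case: i.
rewrite inE /= /comp_seq pairmap_subK; last exact: cut_points_sorted.
rewrite mem_rcons in_cons eqSS ltn_eqF ?ltn_ord //=.
by rewrite (mem_map (f := fun j : 'I_n => j.+1)) ?mem_enum // => j k [] /val_inj.
Qed.

Lemma scanl_add_sorted k s : 0%N \notin s -> path ltn k (scanl addn k s).
Proof.
elim: s k => //= a s IHs k; rewrite in_cons negb_or eq_sym -lt0n.
by case/andP=> a0 /IHs ->; rewrite andbT -addn1 leq_add2l.
Qed.

Lemma last_scanl_add k s : last k (scanl addn k s) = (k + sumn s)%N.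
Proof. by elim: s k => [|a s IHs] k /=; rewrite ?addn0 // IHs addnA. Qed.

Lemma scanl_add_le k s x : x \in scanl addn k s -> (x <= k + sumn s)%N.
Proof.
elim: s k => //= a s IHs k; rewrite in_cons addnA => /orP[/eqP->|/IHs //].
exact: leq_addr.
Qed.

Lemma comp_setK n : cancel (@comp_set n) (@comp_of_set n).
Proof.
case: n => [|n] [s sP]; apply: val_inj => /=.
  by move: sP; case: s => [|[|a] s] //=; rewrite andbF.
have /andP[s0 /eqP sn] := sP.
have /= sS := scanl_add_sorted 0 s0.
rewrite /comp_seq -[RHS](scanlK (f := fun a b => (b - a)%N) addKn 0).
congr (pairmap _ _ _); apply: (irr_sorted_eq ltn_trans ltnn).
- exact: path_sorted (cut_points_sorted _ (ltn0Sn n)).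
- exact: path_sorted sS.
have lS := last_scanl_add 0 s; rewrite add0n sn in lS.
have n1S : n.+1 \in scanl addn 0%N s.
  by rewrite -lS; case: (scanl _ _ _) lS => //= a l _; exact: mem_last.
move=> k; rewrite mem_rcons in_cons; have [->|kn] /= := eqVneq k n.+1.
  by rewrite n1S.
apply/mapP/idP => [[i + ->]|kS]; first by rewrite mem_enum inE.
have k0 : (0 < k)%N.
  by move: sS; rewrite path_sortedE; [case/andP=> /allP/(_ _ kS)|exact: ltn_trans].
have kn1 : (k.-1 < n)%N.
  have := scanl_add_le kS; rewrite add0n sn leq_eqVlt (negPf kn) /=.
  by case: k k0 {kS kn}.
by exists (Ordinal kn1); rewrite ?mem_enum ?inE /= prednK.
Qed.

HB.instance Definition _ n : isFinite (composition n) := CanIsFinite (@comp_setK n).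

Fixpoint refines (beta alpha : seq nat) : bool :=
  if alpha is a :: alpha' then
    [exists k : 'I_(size beta).+1,
       (sumn (take k beta) == a) && refines (drop k beta) alpha']
  else beta == [::].

Lemma refinesP (beta alpha : seq nat) :
  reflect (exists2 bs, beta = flatten bs & alpha = map sumn bs)
          (refines beta alpha).
Proof.
elim: alpha beta => [|a alpha IHa] beta /=.
  by apply: (iffP eqP) => [->|[[|b bs] ->]] //; exists [::].
apply: (iffP existsP) => [[k /andP[/eqP <- /IHa[bs dE ->]]]|].
  by exists (take k beta :: bs); rewrite //= -dE cat_take_drop.
case=> [[|b bs] //= -> [-> aE]].
have sb : (size b < (size (b ++ flatten bs)).+1)%N by rewrite ltnS size_cat leq_addr.
exists (Ordinal sb); rewrite /= take_size_cat // drop_size_cat // eqxx /=.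
by apply/IHa; exists bs.
Qed.

(* i : 'I_n.-1 stands for t = i.+1, so rev_ord i stands for n - t. *)
Definition comp_transpose n (alpha : composition n) : composition n :=
  comp_of_set [set rev_ord i | i in ~: comp_set alpha].

(* N_n = {1, ..., n}. *)
Definition Nset (n : nat) : {fset nat} := [fset k in iota 1 n].

Definition blocks_union (A : seq {fset nat}) : {fset nat} := \bigcup_(B <- A) B.

Definition disjoint_blocks (A : seq {fset nat}) : bool :=
  (fset0 \notin A) && pairwise (fun B C : {fset nat} => [disjoint B & C]%fset) A.

(* The degree n need not be recorded: it is the cardinal of the union. *)
Structure setcomp := SetComp {
  blocks :> seq {fset nat};
  blocksP : disjoint_blocks blocks && (blocks_union blocks == Nset #|` blocks_union blocks|)
}.

HB.instance Definition _ := [isSub for blocks].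
HB.instance Definition _ := [Choice of setcomp by <:].

Definition sc_degree (A : setcomp) : nat := #|` blocks_union A|.

(* On X, this is the order-preserving bijection onto {1, ..., #|X|}. *)
Definition st_rank (X : {fset nat}) (k : nat) : nat :=
  #|` [fset i in X | (i <= k)%N]|.

Definition st_seq (A : seq {fset nat}) : seq {fset nat} :=
  [seq [fset st_rank (blocks_union A) k | k in B] | B : {fset nat} <- A].

Lemma mem_cover A k : (k \in blocks_union A) = has (fun B : {fset nat} => k \in B) A.
Proof.
rewrite /blocks_union; elim: A => [|B A IHA]; first by rewrite big_nil.
by rewrite big_cons /= inE IHA.
Qed.

Lemma rank_inj X : {in X &, injective (st_rank X)}.
Proof.
move=> i j iX jX eij; wlog ij : i j iX jX eij / (i < j)%N => [H|].
  by case: (ltngtP i j) => // ij; [exact: H | apply/esym; exact: H].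
suff : (st_rank X i < st_rank X j)%N by rewrite eij ltnn.
apply: fproper_ltn_card; rewrite fproperE; apply/andP; split.
  by apply/fsubsetP => k; rewrite !inE /= => /andP[-> ki]; rewrite /= (leq_trans ki) // ltnW.
apply/negP => /fsubsetP/(_ j); rewrite !inE /= jX leqnn /= => /(_ isT).
by rewrite leqNgt ij.
Qed.

Lemma card_Nset n : #|` Nset n| = n.
Proof. by rewrite card_fseq undup_id ?iota_uniq // size_iota. Qed.

Lemma rank_img X : [fset st_rank X k | k in X] = Nset #|` X|.
Proof.
apply/eqP; rewrite eqEfcard card_Nset.
have -> : #|` [fset st_rank X k | k in X]| = #|` X|.
  by apply: card_in_imfset; exact: rank_inj.
rewrite leqnn andbT.
apply/fsubsetP => _ /imfsetP[k /= kX ->]; rewrite !inE mem_iota add1n ltnS.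
rewrite fsubset_leq_card ?andbT; last by apply/fsubsetP=> i; rewrite !inE /= => /andP[].
by rewrite cardfs_gt0; apply/fset0Pn; exists k; rewrite !inE /= kX leqnn.
Qed.

Lemma cover_st A : blocks_union (st_seq A) = Nset #|` blocks_union A|.
Proof.
rewrite -rank_img; apply/fsetP => x; rewrite mem_cover has_map.
apply/hasP/imfsetP => [[B BA /= /imfsetP[k kB ->]]|[k /= + ->]].
  by exists k => //=; rewrite mem_cover; apply/hasP; exists B.
by rewrite mem_cover => /hasP[B BA kB]; exists B => //=; apply: in_imfset.
Qed.

Fact st_subproof A : disjoint_blocks A ->
  disjoint_blocks (st_seq A) && (blocks_union (st_seq A) == Nset #|` blocks_union (st_seq A)|).
Proof.
case/andP=> A0 Ad; rewrite cover_st card_Nset eqxx andbT.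
have sub B : B \in A -> {subset B <= blocks_union A}.
  by move=> BA k kB; rewrite mem_cover; apply/hasP; exists B.
apply/andP; split.
  apply/negP => /mapP[B BA B0]; have /fset0Pn[k kB] : B != fset0.
    by apply: contraNneq A0 => <-.
  by have := in_fset0 (st_rank (blocks_union A) k); rewrite B0 in_imfset.
rewrite pairwise_map; apply: (sub_in_pairwise (P := [in A]) _ _ Ad); last by apply/allP.
move=> B C BA CA /= dBC.
apply/fdisjointP => _ /imfsetP[k /= kB ->]; apply/negP => /imfsetP[l /= lC].
move/rank_inj => /(_ (sub _ BA _ kB) (sub _ CA _ lC)) kl; subst l.
by have /fdisjointP/(_ _ kB)/negP := dBC.
Qed.

Definition st (A : seq {fset nat}) (dA : disjoint_blocks A) : setcomp :=
  SetComp (st_subproof dA).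

Fact take_subproof (A : setcomp) k : disjoint_blocks (take k A).
Proof.
have /andP[/andP[A0 Ad] _] := blocksP A; apply/andP; split.
  by apply: contra A0 => /mem_take.
by apply: subseq_pairwise Ad; exact: take_subseq.
Qed.

Fact drop_subproof (A : setcomp) k : disjoint_blocks (drop k A).
Proof.
have /andP[/andP[A0 Ad] _] := blocksP A; apply/andP; split.
  by apply: contra A0 => /mem_drop.
by apply: subseq_pairwise Ad; exact: drop_subseq.
Qed.

Fact setcomp0_subproof : disjoint_blocks [::] && (blocks_union [::] == Nset #|` blocks_union [::]|).
Proof. by rewrite /blocks_union big_nil cardfs0; apply/eqP/fsetP => k; rewrite !inE. Qed.

Definition setcomp0 : setcomp := SetComp setcomp0_subproof.

(* A permutation of {1, ..., n} is encoded by 'S_n, i : 'I_n standing for i.+1. *)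
Definition block_of n (alpha : seq nat) (rho : 'S_n) (j : nat) : {fset nat} :=
  [fset (val (rho k)).+1 | k in
     [set k : 'I_n | sumn (take j alpha) <= k < sumn (take j.+1 alpha)]%N].

Definition comp_blocks n (alpha : composition n) (rho : 'S_n) : seq {fset nat} :=
  [seq block_of alpha rho j | j <- iota 0 (size alpha)].

Lemma sumn_take_le (s : seq nat) i j : (i <= j)%N -> (sumn (take i s) <= sumn (take j s))%N.
Proof.
move=> ij; rewrite -(subnKC ij) addnC.
rewrite -[in leqRHS](cat_take_drop i (take _ s)) sumn_cat take_takel ?leq_addr //.
by rewrite leq_addl.
Qed.

Lemma sumn_take_block (s : seq nat) k : (k < sumn s)%N ->
  exists2 j, (j < size s)%N & (sumn (take j s) <= k < sumn (take j.+1 s))%N.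
Proof.
elim: s k => //= a s IHs k ks; have [ka|ak] := ltnP k a.
  by exists 0%N; rewrite //= take0 addn0.
have [|j js /andP[j1 j2]] := IHs (k - a)%N; first by rewrite ltn_subLR.
by exists j.+1; rewrite //= -leq_subRL // j1 -ltn_subLR.
Qed.

Fact comp_blocks_subproof n (alpha : composition n) (rho : 'S_n) :
  disjoint_blocks (comp_blocks alpha rho) &&
  (blocks_union (comp_blocks alpha rho) == Nset #|` blocks_union (comp_blocks alpha rho)|).
Proof.
have /andP[a0 /eqP an] := comp_valP alpha.
have cE : blocks_union (comp_blocks alpha rho) = Nset n.
  apply/fsetP => x; rewrite mem_cover has_map !inE mem_iota add1n ltnS.
  apply/hasP/andP => [[j _ /= /imfsetP[k _ ->]]|[x0 xn]]; first by split=> //; exact: ltn_ord.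
  have xn' : (x.-1 < n)%N by case: x x0 xn.
  pose k := (rho^-1)%g (Ordinal xn').
  have kn : (k < sumn alpha)%N by rewrite an.
  have [j ja jk] := sumn_take_block kn.
  exists j; first by rewrite mem_iota.
  by apply/imfsetP; exists k; rewrite /= ?inE // permKV /= prednK.
rewrite cE card_Nset eqxx andbT; apply/andP; split.
  apply/negP => /mapP[j]; rewrite mem_iota /= add0n => ja B0.
  have jS : (sumn (take j alpha) < sumn (take j.+1 alpha))%N.
    rewrite (take_nth 0%N) // sumn_rcons -[ltnLHS]addn0 ltn_add2l lt0n.
    by apply: contraNneq a0 => <-; exact: mem_nth.
  have kn : (sumn (take j alpha) < n)%N.
    by apply: (leq_trans jS); rewrite -[X in (_ <= X)%N]an -{2}(take_size alpha) sumn_take_le.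
  suff : (val (rho (Ordinal kn))).+1 \in block_of alpha rho j by rewrite -B0 inE.
  by apply/imfsetP; exists (Ordinal kn); rewrite //= inE /= leqnn.
rewrite pairwise_map; have := iota_ltn_sorted 0 (size alpha).
rewrite sorted_pairwise; last exact: ltn_trans.
apply: sub_pairwise => i j /= ij; apply/fdisjointP => _ /imfsetP[k /= + ->].
rewrite inE => /andP[_ ki]; apply/negP => /imfsetP[l /= + []].
rewrite inE => /andP[jl _] /val_inj/perm_inj kl; subst l.
by have := leq_trans ki (leq_trans (sumn_take_le _ ij) jl); rewrite ltnn.
Qed.

Definition comp_setcomp n (alpha : composition n) (rho : 'S_n) : setcomp :=
  SetComp (comp_blocks_subproof alpha rho).

(* The free module with basis the set compositions; the coefficients are not
   assumed to form a non-trivial ring, as the scaling of malg would require. *)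
Definition NCQSym (R : comPzRingType) : Type := {malg R[setcomp]}.

Section NCQSym.
Variable R : comPzRingType.

HB.instance Definition _ := GRing.Zmodule.on (NCQSym R).

Definition ncq_scale (c : R) (f : NCQSym R) : NCQSym R :=
  [malg A in msupp f => c * f@_A].

Lemma ncq_scaleE c f A : (ncq_scale c f : {malg R[setcomp]})@_A = c * f@_A.
Proof. by rewrite mcoeffE; case: msuppP; rewrite ?mulr0. Qed.

Fact ncq_scaleA c d f : ncq_scale c (ncq_scale d f) = ncq_scale (c * d) f.
Proof. by apply/malgP => A; rewrite !ncq_scaleE mulrA. Qed.

Fact ncq_scale1 : left_id 1 ncq_scale.
Proof. by move=> f; apply/malgP => A; rewrite ncq_scaleE mul1r. Qed.

Fact ncq_scaleDr : right_distributive ncq_scale +%R.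
Proof. by move=> c f g; apply/malgP => A; rewrite !(mcoeffD, ncq_scaleE) mulrDr. Qed.

Fact ncq_scaleDl f : {morph ncq_scale^~ f : c d / c + d}.
Proof. by move=> c d; apply/malgP => A; rewrite !(mcoeffD, ncq_scaleE) mulrDl. Qed.

HB.instance Definition _ := GRing.Zmodule_isLmodule.Build R (NCQSym R)
  ncq_scaleA ncq_scale1 ncq_scaleDr ncq_scaleDl.

Definition Mbasis (A : setcomp) : NCQSym R := << A >>.

Definition Fund n (alpha : composition n) (rho : 'S_n) : NCQSym R :=
  \sum_(beta : composition n | refines beta alpha) Mbasis (comp_setcomp beta rho).

(* Power series in non-commuting variables: the coefficient of each word. The
   variables are numbered from 0. *)
Definition series : Type := seq nat -> R.

Definition series1 : series := fun w => (w == [::])%:R.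

Definition series_mul (f g : series) : series :=
  fun w => \sum_(k < (size w).+1) f (take k w) * g (drop k w).

(* The word of x_I^A. *)
Definition xword (A : setcomp) (I : {fset nat}) : seq nat :=
  [seq nth 0%N (sort leq I) (find (fun B : {fset nat} => k \in B) A)
     | k <- iota 1 (sc_degree A)].

(* Only those I whose elements all occur in w can contribute to the
   coefficient of w in the sum over all I with #|I| = size A. *)
Definition Mseries (A : setcomp) : series := fun w =>
  \sum_(I <- fpowerset [fset i in w] | #|` I| == size A) (xword A I == w)%:R.

Definition to_series (f : NCQSym R) : series :=
  fun w => \sum_(A <- msupp f) f@_A * Mseries A w.

(* NCQSym (x) NCQSym is taken to be the free module on pairs of set
   compositions. *)
Definition comul (f : NCQSym R) : {malg R[(setcomp * setcomp)%type]} :=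
  \sum_(A <- msupp f) \sum_(k < (size A).+1)
    << f@_A *g (st (take_subproof A k), st (drop_subproof A k)) >>.

Definition counit (f : NCQSym R) : R := f@_setcomp0.

(* NCQSym is a subalgebra of the power series (via the injective map to_series),
   so the convolution S * T = mul o (S (x) T) o comul is computed there. *)
Definition convolution (S T : NCQSym R -> NCQSym R) (f : NCQSym R) : series :=
  fun w => \sum_(p <- msupp (comul f)) (comul f)@_p *
    series_mul (to_series (S (Mbasis p.1))) (to_series (T (Mbasis p.2))) w.

Definition is_antipode (S : {linear NCQSym R -> NCQSym R}) : Prop :=
  forall f w,
    convolution S idfun f w = counit f * series1 w /\
    convolution idfun S f w = counit f * series1 w.

End NCQSym.

Definition longest_perm (n : nat) : 'S_n := perm (@rev_ord_inj n).

(* Main.v *)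
(* Everything is computed on coefficients of words. For a composition b, the
   series M_b^Id has coefficient 1 on the words that are constant on the blocks
   of b and strictly increasing from one block to the next, and 0 on all others.
   The equation S * id = counit then determines S(M_b^Id) by induction on the
   length of b: it is (-1)^l(b) times the indicator of the words constant on the
   blocks of b and weakly decreasing from one block to the next, because
     sum_k (-1)^k [v_1 >= ... >= v_k] [v_(k+1) < ... < v_l] = 0  for l > 0.
   Compositions refining a correspond to the sets of cuts containing the cuts of
   a, so summing over them factors as a product over adjacent positions of the
   word. The factor of a position i is
     - [w_i >= w_(i+1)] + [i is not a cut of a] [w_i = w_(i+1)],
   i.e. minus the indicator of w_i >= w_(i+1) or w_i > w_(i+1) according to whether
   i is a cut of a. Read on the reversed word, this is, up to the sign, the factor
   of the coefficient of F_(a^t)^(w0). *)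
Require Import Defs.
From mathcomp Require Import all_boot all_order all_algebra all_fingroup.
From mathcomp Require Import finmap monalg zify.

Set Implicit Arguments.
Unset Strict Implicit.
Unset Printing Implicit Defensive.

Import GRing.Theory.

Local Open Scope fset_scope.
Local Open Scope ring_scope.

(** * Words constant on consecutive blocks of prescribed sizes *)

Definition dup (s v : seq nat) : seq nat :=
  flatten [seq nseq p.1 p.2 | p <- zip s v].

Definition heads (s w : seq nat) : seq nat :=
  [seq head 0%N b | b <- reshape s w].

(** Comparing [w] with [dup] of its own block heads tests constancy on the blocks and also fixes the
    size of [w]. With [r := ltn] this is the coefficient of [w] in M_s^Id, with [r := geq] that of
    its antipode up to sign. *)
Definition block_constant (r : rel nat) (s w : seq nat) : bool :=
  (w == dup s (heads s w)) && sorted r (heads s w).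

Lemma size_heads s w : size (heads s w) = size s.
Proof. by rewrite size_map size_reshape. Qed.

Lemma dup_cons a s x v : dup (a :: s) (x :: v) = nseq a x ++ dup s v.
Proof. by []. Qed.

Lemma dup_cat s1 s2 v1 v2 : size v1 = size s1 ->
  dup (s1 ++ s2) (v1 ++ v2) = dup s1 v1 ++ dup s2 v2.
Proof. by move=> e; rewrite /dup zip_cat // map_cat flatten_cat. Qed.

Lemma size_dup s v : size v = size s -> size (dup s v) = sumn s.
Proof.
by elim: s v => [|a s IHs] [|x v] //= [/IHs e]; rewrite size_cat size_nseq e.
Qed.

Lemma heads_dup (s v : seq nat) :
  0%N \notin s -> size v = size s -> heads s (dup s v) = v.
Proof.
elim: s v => [|[|a] s IHs] [|x v] //= s0 [e]; rewrite dup_cons /heads /=.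
by rewrite drop_size_cat ?size_nseq //; congr (_ :: _); exact: IHs.
Qed.

Lemma block_constantP r (s w : seq nat) : 0%N \notin s ->
  reflect (exists v, [/\ size v = size s, sorted r v & w = dup s v])
          (block_constant r s w).
Proof.
move=> s0; apply: (iffP andP) => [[/eqP wE rv]|[v [vs rv ->]]].
  by exists (heads s w); rewrite size_heads.
by rewrite heads_dup.
Qed.

Lemma block_constant_size r s w : block_constant r s w -> size w = sumn s.
Proof. by case/andP=> /eqP -> _; rewrite size_dup ?size_heads. Qed.

Lemma notin_take (s : seq nat) k : 0%N \notin s -> 0%N \notin take k s.
Proof. by apply: contra => /mem_take. Qed.

Lemma notin_drop (s : seq nat) k : 0%N \notin s -> 0%N \notin drop k s.
Proof. by apply: contra => /mem_drop. Qed.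

(** The two halves glue to one word [dup s v], which forces [v = heads s w] and the cut [m] to be
    the sum of the first [k] sizes. In a convolution product each [k] thus meets at most one [m],
    and the word of heads is the same for all [k]. *)
Lemma block_constant_split r1 r2 (s w : seq nat) k m : 0%N \notin s -> (m <= size w)%N ->
  block_constant r1 (take k s) (take m w) && block_constant r2 (drop k s) (drop m w) =
  [&& m == sumn (take k s), w == dup s (heads s w),
      sorted r1 (take k (heads s w)) & sorted r2 (drop k (heads s w))].
Proof.
move=> s0 mw; apply/andP/and4P => [[]|[/eqP mE /eqP wE r1v r2v]].
  case/(block_constantP _ _ (notin_take k s0)) => v1 [sv1 rv1 w1].
  case/(block_constantP _ _ (notin_drop k s0)) => v2 [sv2 rv2 w2].
  have sv : size (v1 ++ v2) = size s by rewrite size_cat sv1 sv2 -size_cat cat_take_drop.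
  have wE : w = dup s (v1 ++ v2).
    by rewrite -(cat_take_drop m w) w1 w2 -dup_cat // cat_take_drop.
  have hE : heads s w = v1 ++ v2 by rewrite wE heads_dup.
  have mE : m = sumn (take k s) by rewrite -(size_takel mw) w1 size_dup.
  rewrite -mE eqxx hE -wE eqxx.
  suff [-> ->] : take k (v1 ++ v2) = v1 /\ drop k (v1 ++ v2) = v2.
    by [].
  have [ks|sk] := leqP k (size s).
    by rewrite take_size_cat ?drop_size_cat // sv1 size_takel.
  have v20 : v2 = [::] by apply: size0nil; rewrite sv2 drop_oversize // ltnW.
  by rewrite v20 cats0 take_oversize ?drop_oversize // sv1 take_oversize // ltnW.
have st : size (take k (heads s w)) = size (take k s) by rewrite !size_take size_heads.
have sd : size (drop k (heads s w)) = size (drop k s) by rewrite !size_drop size_heads.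
have wE2 : w = dup (take k s) (take k (heads s w)) ++ dup (drop k s) (drop k (heads s w)).
  by rewrite -dup_cat // !cat_take_drop.
have [w1 w2] : take m w = dup (take k s) (take k (heads s w)) /\
               drop m w = dup (drop k s) (drop k (heads s w)).
  by rewrite wE2 take_size_cat ?drop_size_cat ?size_dup -?wE2.
split; apply/block_constantP; rewrite ?notin_take ?notin_drop //.
  by exists (take k (heads s w)).
by exists (drop k (heads s w)).
Qed.

(** * Cuts as partial sums: local description of words and of refinement *)

Lemma scanl_addS m s : scanl addn m.+1 s = map S (scanl addn m s).
Proof. by elim: s m => //= a s IHs m; rewrite -IHs addSn. Qed.

Lemma mem_scanl_addS m s i : (i.+1 \in scanl addn m.+1 s) = (i \in scanl addn m s).
Proof. by rewrite scanl_addS mem_map //; exact: succn_inj. Qed.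

Lemma block_constant_same r a s x y w :
  block_constant r (a.+2 :: s) [:: x, y & w] =
  (x == y) && block_constant r (a.+1 :: s) (y :: w).
Proof.
rewrite /block_constant /heads /= !dup_cons /= !eqseq_cons !eqxx /= [y == x]eq_sym.
by case: eqVneq => //= ->.
Qed.

Lemma block_constant_new r b s x y w :
  block_constant r [:: 1, b.+1 & s]%N [:: x, y & w] =
  r x y && block_constant r (b.+1 :: s) (y :: w).
Proof.
rewrite /block_constant /heads /= !dup_cons /= !eqseq_cons !eqxx /=.
by case: (r x y); rewrite ?andbF.
Qed.

Lemma scanl_add1 s : (1%N \in scanl addn 0%N (1%N :: s)) *
  (forall i, (i.+2 \in scanl addn 0%N (1%N :: s)) = (i.+1 \in scanl addn 0%N s)).
Proof. by split=> [|i] /=; rewrite inE // add0n mem_scanl_addS. Qed.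

Lemma scanl_add2 a s : ((1%N \in scanl addn 0%N (a.+2 :: s)) = false) *
  (forall i, (i.+2 \in scanl addn 0%N (a.+2 :: s)) =
             (i.+1 \in scanl addn 0%N (a.+1 :: s))).
Proof.
split=> [|i] /=; rewrite !inE !add0n ?eqSS mem_scanl_addS //.
by rewrite scanl_addS; apply/mapP => -[].
Qed.

(** Partial sums of [s] are the positions where blocks end, so each adjacent pair of letters carries
    its own test. The induction drops the first letter, which either closes a block of size 1 or
    shortens the first block by one. *)
Lemma block_constant_stepsP r (s w : seq nat) : 0%N \notin s -> size w = sumn s ->
  reflect (forall i, (i.+1 < sumn s)%N ->
             if i.+1 \in scanl addn 0%N s then r (nth 0%N w i) (nth 0%N w i.+1)
             else nth 0%N w i == nth 0%N w i.+1)
          (block_constant r s w).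
Proof.
elim: w s => [|x w IHw] [|[|a] s] // s0 sw.
  by apply: (iffP idP).
have s0' : 0%N \notin s by apply: contra s0; rewrite inE => ->; rewrite orbT.
case: a s0 sw => [|a] s0 sw.
  case: s s0' s0 sw => [|[|b] s] // s0' s0 sw.
    case: w IHw sw => // _ _; rewrite /block_constant /heads /= /dup /= eqxx.
    by apply: (iffP idP).
  case: w IHw sw => // y w IHw /succn_inj sw.
  rewrite block_constant_new; apply: (iffP andP) => [[rxy bw] [|i] i_lt|H].
  - by rewrite scanl_add1.
  - by rewrite scanl_add1; exact: (elimT (IHw (b.+1 :: s) s0' sw)).
  split; first by have := H 0%N isT; rewrite scanl_add1.
  by apply/IHw => // i i_lt; have := H i.+1 i_lt; rewrite scanl_add1.
case: w IHw sw => // y w IHw /succn_inj sw; rewrite block_constant_same.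
have s1 : 0%N \notin a.+1 :: s by [].
apply: (iffP andP) => [[xy bw] [|i] i_lt|H].
- by rewrite scanl_add2.
- by rewrite scanl_add2; exact: (elimT (IHw (a.+1 :: s) s1 sw)).
split; first by have := H 0%N isT; rewrite scanl_add2.
by apply/IHw => // i i_lt; have := H i.+1 i_lt; rewrite scanl_add2.
Qed.

Lemma scanl_add_gt m (s : seq nat) x : 0%N \notin s -> x \in scanl addn m s -> (m < x)%N.
Proof.
elim: s m => //= a s IHs m; rewrite inE negb_or eq_sym -lt0n => /andP[a0 s0].
rewrite inE => /orP[/eqP->|/(IHs _ s0)]; first by rewrite -addn1 leq_add2l.
by apply: leq_trans; rewrite ltnS leq_addr.
Qed.

Lemma mem_scanl_addP m s y :
  reflect (exists2 k, (k < size s)%N & y = (m + sumn (take k.+1 s))%N)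
          (y \in scanl addn m s).
Proof.
elim: s m y => [|a s IHs] m y /=; first by apply: (iffP idP) => // -[].
rewrite inE; apply: (iffP orP) => [[/eqP->|/IHs[k ks ->]]|[[|k] ks ->]].
- by exists 0%N; rewrite // take0 /= addn0.
- by exists k.+1; rewrite //= addnA.
- by left; rewrite take0 /= addn0.
- by right; apply/IHs; exists k; rewrite //= addnA.
Qed.

(** The offset [m] is general because removing the first entry of [a], and the part of [b] below it,
    moves the start of both lists of partial sums. *)
Lemma refines_scanlP m (b a : seq nat) :
  0%N \notin b -> 0%N \notin a -> sumn b = sumn a ->
  reflect {subset scanl addn m a <= scanl addn m b} (refines b a).
Proof.
elim: a m b => [|x a IHa] m b b0 a0 ba /=.
  apply: (iffP eqP) => [_ y //|_]; case: b b0 ba => [|y b] //=.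
  by rewrite inE negb_or eq_sym -lt0n; case: y.
move: a0; rewrite inE negb_or eq_sym -lt0n => /andP[x0 a0].
have scanlE k : scanl addn m b =
    scanl addn m (take k b) ++ scanl addn (m + sumn (take k b))%N (drop k b).
  rewrite -{1}(cat_take_drop k b) scanl_cat; congr (_ ++ scanl _ _ _).
  by elim: (take k b) m => [|c l IHl] m /=; rewrite ?addn0 // IHl addnA.
have sumE k : (sumn (take k b) + sumn (drop k b))%N = (x + sumn a)%N.
  by rewrite -sumn_cat cat_take_drop.
apply: (iffP existsP) => [[k /andP[/eqP kx]]|H].
  move/(IHa (m + x)%N); move=> /(_ (notin_drop _ b0) a0).
  have -> : sumn (drop k b) = sumn a by apply/eqP; rewrite -(eqn_add2l x) -(sumE k) kx.
  move=> /(_ erefl) H y; rewrite (scanlE k) kx mem_cat inE => /orP[/eqP->|/H -> //].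
    have k0 : (0 < k)%N.
      by rewrite lt0n; apply: contraTneq x0 => k0; rewrite -kx k0 take0.
    have sk : size (take k b) = k by rewrite size_takel // -ltnS.
    apply/orP; left; apply/mem_scanl_addP; exists k.-1; rewrite ?sk prednK //.
    by rewrite take_oversize ?sk // kx.
  by rewrite orbT.
(* The first partial sum of [a] is also one of [b]; its index there tells where to cut [b]. *)
have mx : (m + x)%N \in scanl addn m b by apply: H; rewrite mem_head.
have [k kb kx] : exists2 k, (k <= size b)%N & sumn (take k b) = x.
  by have /mem_scanl_addP[k kb /addnI ->] := mx; exists k.+1.
exists (Ordinal (kb : (k < (size b).+1)%N)) => /=; rewrite kx eqxx /=.
apply/(IHa (m + x)%N) => //; first exact: notin_drop.
  by apply/eqP; rewrite -(eqn_add2l x) -(sumE k) kx.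
(* A later partial sum of [a] exceeds [m + x], while those of the first [k] entries of [b] do not,
   so [y] comes from the rest of [b]. *)
move=> y ya; have := H y; rewrite inE ya orbT (scanlE k) kx mem_cat => /(_ isT).
case/orP => // /scanl_add_le; rewrite kx => yx.
by have := scanl_add_gt a0 ya; rewrite ltnNge yx.
Qed.

(** * The alternating sum that inverts the strictly increasing words *)

Lemma alternating_path (R : pzRingType) x v :
  \sum_(k < (size v).+1)
     (-1) ^+ k * (path geq x (take k v) && sorted ltn (drop k v))%:R =
  (path ltn x v)%:R :> R.
Proof.
elim: v x => [|y v IHv] x; first by rewrite big_ord1 mul1r.
rewrite big_ord_recl /= mul1r.
under eq_bigr do rewrite /bump /= exprS mulN1r mulNr.
(* The term [k = 0] is [path ltn y v]. If [y <= x], the other terms add up to its opposite by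
   induction; if [x < y], they all vanish. *)
rewrite sumrN; case: leqP => [yx|xy] /=; first by rewrite IHv subrr.
by rewrite big1 ?subr0 // => k _; rewrite mulr0.
Qed.

Lemma alternating_sorted (R : pzRingType) v :
  \sum_(k < (size v).+1)
     (-1) ^+ k * (sorted geq (take k v) && sorted ltn (drop k v))%:R =
  (v == [::])%:R :> R.
Proof.
case: v => [|x v]; first by rewrite big_ord1 mul1r.
rewrite big_ord_recl /= mul1r.
under eq_bigr do rewrite /bump /= exprS mulN1r mulNr.
by rewrite sumrN alternating_path subrr.
Qed.

(** By [block_constant_split] the inner sum has at most one nonzero term, and the double sum
    collapses to [alternating_sorted] for [heads s w]. *)
Lemma alternating_block_constant (R : pzRingType) (s w : seq nat) : 0%N \notin s ->
  \sum_(k < (size s).+1) \sum_(m < (size w).+1)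
     (-1) ^+ k * (block_constant geq (take k s) (take m w))%:R *
     (block_constant ltn (drop k s) (drop m w))%:R =
  ((s == [::]) && (w == [::]))%:R :> R.
Proof.
move=> s0.
have -> : (s == [::]) && (w == [::]) = (w == dup s (heads s w)) && (heads s w == [::]).
  case: s s0 => [|a s] _; first by rewrite /dup /heads /= andbT.
  by rewrite andbF.
rewrite -mulnb natrM -alternating_sorted size_heads mulr_sumr; apply: eq_bigr => k _.
have [wE|wE] := eqVneq w (dup s (heads s w)); last first.
  rewrite mul0r big1 // => m _; rewrite -mulrA -natrM mulnb.
  rewrite (block_constant_split _ _ _ s0 (ltn_ord m : (m <= size w)%N)).
  by rewrite (negPf wE) andbF mulr0.
have kw : (sumn (take k s) < (size w).+1)%N.
  rewrite ltnS wE size_dup ?size_heads // -[in leqRHS](cat_take_drop k s).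
  by rewrite sumn_cat leq_addr.
rewrite mul1r (bigD1 (Ordinal kw)) //= big1 ?addr0 => [|m mk].
  rewrite -mulrA -natrM mulnb block_constant_split //.
  by rewrite -wE !eqxx.
rewrite -mulrA -natrM mulnb (block_constant_split _ _ _ s0 (ltn_ord m : (m <= size w)%N)).
by rewrite -val_eqE /= in mk; rewrite (negPf mk) mulr0.
Qed.

(** * Sums over refinements as products over adjacent positions *)

Lemma comp_notin0 n (beta : composition n) : 0%N \notin comp_val beta.
Proof. by case/andP: (comp_valP beta). Qed.

Lemma sumn_comp n (beta : composition n) : sumn beta = n.
Proof. by case/andP: (comp_valP beta) => _ /eqP. Qed.

Lemma refines_comp_set n (beta alpha : composition n) :
  refines beta alpha = (comp_set alpha \subset comp_set beta).
Proof.
apply/(refines_scanlP 0%N (comp_notin0 _) (comp_notin0 _) _)/subsetP => [|H i|H x xa].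
- by rewrite !sumn_comp.
- by rewrite !inE => /H.
have x0 := scanl_add_gt (comp_notin0 _) xa.
have := scanl_add_le xa; rewrite add0n sumn_comp leq_eqVlt => /predU1P[xn|xn].
  (* The total [n] is a partial sum that [comp_set] does not record; it is the last partial sum of
     [beta] as well, and [x0] excludes an empty list. *)
  have lE := last_scanl_add 0%N beta; rewrite add0n sumn_comp -[in RHS]xn in lE.
  by move: x0; rewrite -lE; case: (scanl _ _ _) => //= y l _; rewrite mem_last.
have xn1 : (x.-1 < n.-1)%N by rewrite ltn_predRL prednK.
by have := H (Ordinal xn1); rewrite !inE /= prednK //; exact.
Qed.

Lemma size_comp n (beta : composition n) :
  size beta = ((0 < n) + #|comp_set beta|)%N.
Proof.
rewrite -[in LHS](comp_setK beta); case: n beta => [|n] beta /=.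
  by rewrite (_ : comp_set _ = set0) ?cards0 //; apply/setP => -[].
by rewrite size_pairmap size_rcons size_map -cardE.
Qed.

Lemma block_constant_comp r n (beta : composition n) w : size w = n ->
  block_constant r beta w =
  [forall i : 'I_n.-1, if i \in comp_set beta then r (nth 0%N w i) (nth 0%N w i.+1)
                       else nth 0%N w i == nth 0%N w i.+1].
Proof.
move=> wn; apply/(block_constant_stepsP _ (comp_notin0 _) _)/forallP => [|H i|H i].
- by rewrite wn sumn_comp.
- by rewrite inE; apply: H; rewrite sumn_comp -ltn_predRL.
by rewrite sumn_comp -ltn_predRL => i_lt; have := H (Ordinal i_lt); rewrite inE.
Qed.

Lemma prod_natb (R : comPzRingType) (I : finType) (P : pred I) :
  \prod_i (P i)%:R = [forall i, P i]%:R :> R.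
Proof.
have [/forallP PT|/forallPn[i Pi]] := boolP [forall i, P i].
  by rewrite big1 // => i _; rewrite PT.
by rewrite (bigD1 i) //= (negPf Pi) mul0r.
Qed.

(** Each cut of [beta] brings a factor [c] for the block that it ends. The last block, present only
    for [n > 0], ends at no recorded cut and gives the factor in front. *)
Lemma sum_block_constant (R : comPzRingType) (c : R) r n (alpha : composition n) w :
  size w = n ->
  \sum_(beta : composition n | refines beta alpha)
     c ^+ size beta * (block_constant r beta w)%:R =
  c ^+ (0 < n)%N * \prod_(i < n.-1)
     (c * (r (nth 0%N w i) (nth 0%N w i.+1))%:R +
      ((i \notin comp_set alpha) && (nth 0%N w i == nth 0%N w i.+1))%:R).
Proof.
(* Distributivity turns the product over positions into a sum over subsets. *)
move=> wn; rewrite bigA_distr.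
rewrite (reindex (@comp_of_set n)); last first.
  by exists (@comp_set n) => ? _; rewrite ?compK ?comp_setK.
rewrite mulr_sumr big_mkcond; apply: eq_bigr => T _.
rewrite refines_comp_set block_constant_comp // size_comp compK.
have [/subsetP sT|/subsetPn[i iA iT]] := boolP (_ \subset _); last first.
  by rewrite (bigD1 i) //= (negPf iT) iA mul0r mulr0.
rewrite exprD -mulrA; congr (_ * _).
rewrite -prodr_const big_mkcond /= -prod_natb -big_split /=.
apply: eq_bigr => i _; case: ifPn => [iT|iT]; first by [].
by rewrite mul1r (contra (sT i) iT).
Qed.

Lemma sum_block_constant_transpose (R : comPzRingType) n (alpha : composition n) w :
  \sum_(beta : composition n | refines beta alpha)
     (-1) ^+ size beta * (block_constant geq beta w)%:R =
  (-1) ^+ n * \sum_(beta : composition n | refines beta (comp_transpose alpha))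
     ((size w == n) && block_constant ltn beta (rev w))%:R :> R.
Proof.
have [wn|wn] := eqVneq (size w) n; last first.
  rewrite !big1 ?mulr0 // => beta _.
  have [/block_constant_size|] := boolP (block_constant _ _ _); last by rewrite mulr0.
  by move/eqP; rewrite sumn_comp (negPf wn).
have := @sum_block_constant R 1 ltn n (comp_transpose alpha) (rev w).
under eq_bigr do rewrite expr1n mul1r.
rewrite expr1n mul1r => -> //; last by rewrite size_rev.
rewrite sum_block_constant // /comp_transpose compK.
(* One sign for the last block, if any, and one for each adjacent position. *)
have -> : (-1) ^+ n = (-1) ^+ (0 < n)%N * \prod_(i < n.-1) -1 :> R.
  by rewrite prodr_const card_ord -exprD; case: n {alpha wn}.
(* [rev_ord] matches letters [i] and [i.+1] of [w] with the place that holds them, swapped, in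
   [rev w]; it also undoes the reflection in [comp_transpose]. *)
rewrite -mulrA; congr (_ * _); rewrite -big_split /= [RHS](reindex_inj rev_ord_inj) /=.
apply: eq_bigr => i _; have := ltn_ord i; rewrite ltn_predRL => i_lt.
rewrite (mem_imset _ _ rev_ord_inj) in_setC negbK.
have -> : nth 0%N (rev w) (n.-1 - i.+1) = nth 0%N w i.+1.
  by rewrite nth_rev ?wn; [congr nth|]; lia.
have -> : nth 0%N (rev w) (n.-1 - i.+1).+1 = nth 0%N w i.
  by rewrite nth_rev ?wn; [congr nth|]; lia.
rewrite !mul1r !mulN1r opprD /= [nth _ _ _ == nth _ _ i]eq_sym.
(* At a cut of [alpha], weak descent splits into strict descent and equality; elsewhere equality is
   subtracted from weak descent. *)
by case: (i \in _); case: ltngtP => _ /=; rewrite ?(oppr0, sub0r, subr0, addr0, addNr).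
Qed.

(** * Word coefficients of M_A for a set composition A *)

Definition block_index (A : seq {fset nat}) (k : nat) : nat :=
  find (fun B : {fset nat} => k \in B) A.

(** The word of x_I^A with I given by a list: [xword A I] is [set_word A (sort leq I)]. *)
Definition set_word (A : setcomp) (v : seq nat) : seq nat :=
  [seq nth 0%N v (block_index A k) | k <- iota 1 (sc_degree A)].

Lemma mem_setcomp (A : setcomp) k :
  has (fun B : {fset nat} => k \in B) A = (k \in iota 1 (sc_degree A)).
Proof.
by rewrite -mem_cover; case/andP: (blocksP A) => _ /eqP ->; rewrite inE.
Qed.

Lemma block_index_lt (A : setcomp) k :
  k \in iota 1 (sc_degree A) -> (block_index A k < size A)%N.
Proof. by rewrite -mem_setcomp has_find. Qed.

Lemma block_indexP (A : setcomp) k j : (j < size A)%N ->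
  (k \in nth fset0 A j) = (k \in iota 1 (sc_degree A)) && (block_index A k == j).
Proof.
move=> jA; apply/idP/andP => [kj|[kA /eqP<-]]; last first.
  by rewrite -mem_setcomp in kA; exact: (nth_find fset0 kA).
have kA : has (fun B : {fset nat} => k \in B) A.
  by apply/hasP; exists (nth fset0 A j) => //; exact: mem_nth.
split; first by rewrite -mem_setcomp.
have /andP[/andP[_ Ad] _] := blocksP A.
have ki : k \in nth fset0 A (block_index A k) := nth_find fset0 kA.
have iA : (block_index A k < size A)%N by rewrite -has_find.
have /pairwiseP dA := Ad.
apply/eqP; case: (ltngtP (block_index A k) j) => // ij; exfalso.
  by have /fdisjointP/(_ _ ki) := dA fset0 _ _ iA jA ij; rewrite kj.
by have /fdisjointP/(_ _ kj) := dA fset0 _ _ jA iA ij; rewrite ki.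
Qed.

Lemma block_index_onto (A : setcomp) j : (j < size A)%N ->
  exists2 k, k \in iota 1 (sc_degree A) & block_index A k = j.
Proof.
move=> jA; have /andP[/andP[A0 _] _] := blocksP A.
have /fset0Pn[k] : nth fset0 A j != fset0.
  by apply: contraNneq A0 => <-; exact: mem_nth.
by rewrite block_indexP // => /andP[kA /eqP kj]; exists k.
Qed.

Lemma mem_set_word (A : setcomp) v : size v = size A -> set_word A v =i v.
Proof.
move=> vA x; apply/mapP/idP => [[k kA ->]|/(nthP 0%N)[j]].
  by rewrite mem_nth // vA block_index_lt.
rewrite vA => /block_index_onto[k kA <-] <-.
by exists k.
Qed.

Lemma sort_fset_ltn (I : {fset nat}) : sorted ltn (sort leq I).
Proof.
by rewrite ltn_sorted_uniq_leq sort_uniq fset_uniq sort_sorted //; exact: leq_total.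
Qed.

(** Every block is nonempty, so I is recovered as the set of letters of the word. Hence at most one
    term of the sum is nonzero. *)
Lemma MseriesE (R : comPzRingType) (A : setcomp) w (b : bool) :
  reflect (exists v, [/\ sorted ltn v, size v = size A & w = set_word A v]) b ->
  Mseries R A w = b%:R.
Proof.
move=> bP; pose I0 := [fset i in w].
have -> : b = (#|` I0| == size A) && (xword A I0 == w).
  apply/bP/andP => [[v [vs vA wE]]|[/eqP IA /eqP <-]]; last first.
    by exists (sort leq I0); rewrite size_sort; split=> //; exact: sort_fset_ltn.
  have vE : sort leq I0 = v.
    apply: (irr_sorted_eq ltn_trans ltnn (sort_fset_ltn _) vs) => x.
    by rewrite mem_sort !inE wE mem_set_word.
  by rewrite -[#|` _|](size_sort leq) wE /xword vE vA !eqxx.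
rewrite /Mseries big_mkcond (bigD1_seq I0) ?fset_uniq ?fpowersetE //=.
rewrite big1 ?addr0 => [|I IN]; first by case: eqP.
case: ifP => // /eqP IA; case: eqP => // wE; case/eqP: IN.
apply/fsetP => x; rewrite !inE -wE.
by rewrite (_ : xword A I = set_word A (sort leq I)) // mem_set_word ?size_sort // mem_sort.
Qed.

(** * Linearity and injectivity of the passage to power series *)

Section CoefficientSums.
Variables (K : choiceType) (R : comPzRingType) (H : K -> R).

Lemma sum_msupp_sub (f : {malg R[K]}) (d : {fset K}) : msupp f `<=` d ->
  \sum_(k <- msupp f) f@_k * H k = \sum_(k <- d) f@_k * H k.
Proof.
by move=> fd; apply: big_fset_incl => // k _ /mcoeff_outdom ->; rewrite mul0r.
Qed.

Lemma sum_msuppU c k :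
  \sum_(i <- msupp << c *g k >>) (<< c *g k >> : {malg R[K]})@_i * H i = c * H k.
Proof. by rewrite (sum_msupp_sub msuppU_le) big_seq_fset1 mcoeffUU. Qed.

Lemma sum_msuppD (f g : {malg R[K]}) :
  \sum_(k <- msupp (f + g)) (f + g)@_k * H k =
  \sum_(k <- msupp f) f@_k * H k + \sum_(k <- msupp g) g@_k * H k.
Proof.
rewrite (sum_msupp_sub (msuppD_le f g)) (sum_msupp_sub (fsubsetUl _ (msupp g))).
rewrite (sum_msupp_sub (fsubsetUr (msupp f) _)) -big_split.
by apply: eq_bigr => k _; rewrite mcoeffD mulrDl.
Qed.

Lemma sum_msupp_sum (I : Type) (r : seq I) (P : pred I) (F : I -> {malg R[K]}) :
  \sum_(k <- msupp (\sum_(i <- r | P i) F i)) (\sum_(i <- r | P i) F i)@_k * H k =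
  \sum_(i <- r | P i) \sum_(k <- msupp (F i)) (F i)@_k * H k.
Proof.
pose ev (f : {malg R[K]}) := \sum_(k <- msupp f) f@_k * H k.
apply: (big_morph ev sum_msuppD); by rewrite /ev msupp0 big_seq_fset0.
Qed.

End CoefficientSums.

Section ToSeries.
Variable R : comPzRingType.
Implicit Types (f g : NCQSym R) (w : seq nat).

Lemma to_series_Mbasis A w : to_series (Mbasis R A) w = Mseries R A w.
Proof. by rewrite /to_series sum_msuppU mul1r. Qed.

Lemma to_series_sum (I : Type) (r : seq I) (P : pred I) (F : I -> NCQSym R) w :
  to_series (\sum_(i <- r | P i) F i) w = \sum_(i <- r | P i) to_series (F i) w.
Proof. exact: sum_msupp_sum. Qed.

Lemma to_seriesZ c f w : to_series (c *: f) w = c * to_series f w.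
Proof.
have sZ : msupp (c *: f : {malg R[setcomp]}) `<=` msupp f.
  apply/fsubsetP => A; rewrite -!mcoeff_neq0 ncq_scaleE.
  by apply: contraNneq => ->; rewrite mulr0.
rewrite /to_series (sum_msupp_sub _ sZ).
by rewrite mulr_sumr; apply: eq_bigr => A _; rewrite ncq_scaleE mulrA.
Qed.

(** This test word writes at each position the index of its block in [A], so [A] can be read off
    from it; it serves to extract the coefficient at [A]. *)
Lemma Mseries_index_word (A B : setcomp) :
  Mseries R B (set_word A (iota 0 (size A))) = (B == A)%:R.
Proof.
have idxE k : k \in iota 1 (sc_degree A) ->
    nth 0%N (iota 0 (size A)) (block_index A k) = block_index A k.
  by move=> kA; rewrite nth_iota // block_index_lt.
apply: MseriesE; apply: (iffP eqP) => [->|[v [vs vB wE]]].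
  by exists (iota 0 (size A)); rewrite size_iota iota_ltn_sorted.
have AB : sc_degree A = sc_degree B.
  by have := congr1 size wE; rewrite !size_map !size_iota.
have vE : v = iota 0 (size A).
  apply: (irr_sorted_eq ltn_trans ltnn vs (iota_ltn_sorted _ _)) => x.
  by rewrite -(mem_set_word vB) -wE mem_set_word // size_iota.
have szE : size B = size A by rewrite -vB vE size_iota.
apply/val_inj/(eq_from_nth (x0 := fset0)) => // j jB; apply/fsetP => k.
rewrite !block_indexP -?szE // -AB; case: (boolP (k \in _)) => //= kA.
congr (_ == _); move: wE; rewrite /set_word -AB => /eq_in_map/(_ k kA).
by rewrite vE idxE // nth_iota // -szE block_index_lt // -AB.
Qed.

Lemma to_series_inj f g : to_series f =1 to_series g -> f = g.
Proof.
have coef h A : to_series h (set_word A (iota 0 (size A))) = (h : {malg R[setcomp]})@_A.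
  rewrite /to_series; under eq_bigr do rewrite Mseries_index_word.
  (* [A] is adjoined to the index set because it may lie outside the support of [h]. *)
  rewrite (sum_msupp_sub _ (fsubsetUr [fset A] _)) (big_fsetD1 A) ?inE ?eqxx //=.
  rewrite mulr1 big1_fset ?addr0 // => B; rewrite !inE => /andP[/negPf -> _] _.
  by rewrite mulr0.
by move=> fg; apply/malgP => A; rewrite -!coef fg.
Qed.

End ToSeries.

(** * Word coefficients of M_beta^rho *)

Lemma nth_dup (s v : seq nat) i j : size v = size s ->
  (sumn (take j s) <= i < sumn (take j.+1 s))%N -> nth 0%N (dup s v) i = nth 0%N v j.
Proof.
elim: s v i j => [|a s IHs] [|x v] i j // /succn_inj vs.
rewrite dup_cons nth_cat size_nseq; case: j => [|j] /=.
  by rewrite take0 /= addn0 => ia; rewrite ia nth_nseq ia.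
case/andP=> ai ia; have ai' := leq_trans (leq_addr _ _) ai.
by rewrite ltnNge ai' /=; apply: IHs => //; rewrite leq_subRL // ltn_subLR // ai.
Qed.

Section CompSetcomp.
Variables (n : nat) (beta : composition n) (rho : 'S_n).

Lemma mem_block_of j (i : 'I_n) :
  ((rho i).+1 \in block_of beta rho j) =
  (sumn (take j beta) <= i < sumn (take j.+1 beta))%N.
Proof.
apply/imfsetP/idP => [[k /= + [/val_inj/perm_inj ->]]|H]; first by rewrite inE.
by exists i; rewrite //= inE.
Qed.

Lemma sc_degree_comp : sc_degree (comp_setcomp beta rho) = n.
Proof.
have sub k : k \in iota 1 (sc_degree (comp_setcomp beta rho)) = (0 < k <= n)%N.
  rewrite -mem_setcomp /= has_map; apply/hasP/andP => [[j _ /= /imfsetP[i _ ->]]|[k0 kn]].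
    by split=> //; exact: ltn_ord.
  have kn' : (k.-1 < n)%N by rewrite prednK.
  pose i := (rho^-1)%g (Ordinal kn').
  have ib : (i < sumn beta)%N by rewrite sumn_comp.
  have [j ja ji] := sumn_take_block ib.
  exists j; first by rewrite mem_iota.
  have -> : k = (rho i).+1 by rewrite permKV /= prednK.
  by rewrite /= mem_block_of.
move: (sc_degree _) sub => d sub.
(* The initial intervals up to [d] and up to [n] coincide; testing both endpoints gives [d = n]. *)
by have := sub n; have := sub d; rewrite !mem_iota; lia.
Qed.

Lemma block_index_comp (i : 'I_n) (j := block_index (comp_setcomp beta rho) (rho i).+1) :
  (sumn (take j beta) <= i < sumn (take j.+1 beta))%N.
Proof.
have iA : (rho i).+1 \in iota 1 (sc_degree (comp_setcomp beta rho)).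
  by rewrite sc_degree_comp mem_iota; exact: ltn_ord (rho i).
rewrite -mem_block_of; have := block_index_lt iA; rewrite -/j => jA.
have jb : (j < size beta)%N by rewrite size_map size_iota in jA.
have := block_indexP (rho i).+1 jA; rewrite iA eqxx /=.
by rewrite (nth_map 0%N) ?size_iota ?nth_iota.
Qed.

(** The blocks are images under [rho] of consecutive intervals, so reading [w] in the order given by
    [rho] turns them into consecutive runs. The reread word has [n] letters whatever [w] is, hence
    the separate test on [size w]. *)
Lemma Mseries_comp (R : comPzRingType) w :
  Mseries R (comp_setcomp beta rho) w =
  ((size w == n) &&
   block_constant ltn beta [seq nth 0%N w (rho i) | i <- enum 'I_n])%:R.
Proof.
have sA : size (comp_setcomp beta rho) = size beta by rewrite size_map size_iota.
have nth_set_word v (i : 'I_n) : size v = size beta ->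
    nth 0%N (set_word (comp_setcomp beta rho) v) (rho i) = nth 0%N (dup beta v) i.
  move=> vs; rewrite (nth_map 0%N) sc_degree_comp ?size_iota ?nth_iota //.
  by rewrite add1n (nth_dup vs (block_index_comp i)).
apply: MseriesE; apply: (iffP andP) => [[/eqP wn /(block_constantP _ _ (comp_notin0 _))]|].
  case=> v [vs rv vE]; exists v; rewrite sA; split=> //.
  have sw : size (set_word (comp_setcomp beta rho) v) = n.
    by rewrite size_map size_iota sc_degree_comp.
  apply: (eq_from_nth (x0 := 0%N)); rewrite ?sw // => k; rewrite wn => kn.
  have := nth_set_word v ((rho^-1)%g (Ordinal kn)) vs; rewrite permKV /= => ->.
  rewrite -vE (nth_map (Ordinal kn)) ?size_enum_ord //.
  by rewrite nth_ord_enum permKV.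
case=> v [rv vA wE]; rewrite sA in vA.
split; first by rewrite wE size_map size_iota sc_degree_comp.
apply/(block_constantP _ _ (comp_notin0 _)); exists v; split=> //.
apply: (eq_from_nth (x0 := 0%N));
  first by rewrite size_dup // sumn_comp size_map size_enum_ord.
move=> k; rewrite size_map size_enum_ord => kn.
rewrite (nth_map (Ordinal kn)) ?size_enum_ord //.
by rewrite (nth_ord_enum (Ordinal kn) (Ordinal kn)) wE nth_set_word.
Qed.

End CompSetcomp.

Lemma Mseries_comp1 (R : comPzRingType) n (beta : composition n) w :
  Mseries R (comp_setcomp beta 1%g) w = (block_constant ltn beta w)%:R.
Proof.
rewrite Mseries_comp; congr (nat_of_bool _)%:R.
have [wn|wn] /= := eqVneq (size w) n.
  congr (block_constant _ _ _);
  rewrite -[RHS](mkseq_nth 0%N) /mkseq wn -val_enum_ord -map_comp.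
  by apply: eq_map => i /=; rewrite perm1.
by apply/esym/negP => /block_constant_size/eqP; rewrite sumn_comp (negPf wn).
Qed.

Lemma Mseries_comp_longest (R : comPzRingType) n (beta : composition n) w :
  Mseries R (comp_setcomp beta (longest_perm n)) w =
  ((size w == n) && block_constant ltn beta (rev w))%:R.
Proof.
rewrite Mseries_comp; have [wn|wn] //= := eqVneq (size w) n.
congr (nat_of_bool (block_constant _ _ _))%:R.
apply: (eq_from_nth (x0 := 0%N)); first by rewrite size_map size_enum_ord size_rev.
move=> k; rewrite size_map size_enum_ord => kn.
rewrite (nth_map (Ordinal kn)) ?size_enum_ord // (nth_ord_enum (Ordinal kn) (Ordinal kn)).
by rewrite permE /= nth_rev ?wn.
Qed.

(** * Deconcatenation and standardization of consecutive blocks *)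

Definition interval (m a : nat) : {fset nat} := [fset k in iota m.+1 a].

(** The offset [m] makes this family closed under [drop], so that both tensor factors of the
    co-multiplication of M_beta^Id stay in it before standardization. *)
Fixpoint interval_blocks (m : nat) (s : seq nat) : seq {fset nat} :=
  if s is a :: s' then interval m a :: interval_blocks (m + a) s' else [::].

Lemma mem_interval m a k : (k \in interval m a) = (m < k <= m + a)%N.
Proof. by rewrite inE mem_iota addSn ltnS. Qed.

Lemma size_interval_blocks m s : size (interval_blocks m s) = size s.
Proof. by elim: s m => //= a s IHs m; rewrite IHs. Qed.

Lemma nth_interval_blocks m s j : (j < size s)%N ->
  nth fset0 (interval_blocks m s) j = interval (m + sumn (take j s)) (nth 0%N s j).
Proof.
elim: s m j => // a s IHs m [|j] /=; first by rewrite addn0.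
by move=> js; rewrite IHs // addnA.
Qed.

Lemma take_interval_blocks m s k :
  take k (interval_blocks m s) = interval_blocks m (take k s).
Proof. by elim: s m k => [|a s IHs] m [|k] //=; rewrite IHs. Qed.

Lemma drop_interval_blocks m s k :
  drop k (interval_blocks m s) = interval_blocks (m + sumn (take k s)) (drop k s).
Proof.
by elim: s m k => [|a s IHs] m [|k] //=; rewrite ?addn0 // IHs addnA.
Qed.

Lemma blocks_union_interval m s :
  blocks_union (interval_blocks m s) = interval m (sumn s).
Proof.
elim: s m => [|a s IHs] m; apply/fsetP => k.
  by rewrite mem_cover mem_interval addn0 /=; lia.
rewrite /blocks_union /= big_cons -/(blocks_union _) IHs in_fsetU !mem_interval.
by lia.
Qed.

Lemma st_rank_interval m a k : k \in interval m a -> st_rank (interval m a) k = (k - m)%N.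
Proof.
rewrite mem_interval => kI; rewrite -[RHS](size_iota m.+1) -(undup_id (iota_uniq m.+1 _)).
rewrite -card_fseq /st_rank; congr #|` _|; apply/fsetP => i.
by rewrite !inE /= !mem_iota; lia.
Qed.

(** The union of the blocks is an interval, on which the rank is subtraction of [m]. *)
Lemma st_seq_interval m s : st_seq (interval_blocks m s) = interval_blocks 0 s.
Proof.
rewrite /st_seq blocks_union_interval.
apply: (eq_from_nth (x0 := fset0)) => [|j];
  rewrite size_map !size_interval_blocks // => js.
rewrite (nth_map fset0) ?size_interval_blocks // !nth_interval_blocks // add0n.
have sb : (sumn (take j s) + nth 0 s j <= sumn s)%N.
  by rewrite -sumn_rcons -take_nth // -[in leqRHS](take_size s) sumn_take_le.
have in_I k : k \in interval (m + sumn (take j s)) (nth 0%N s j) ->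
    k \in interval m (sumn s).
  by rewrite !mem_interval; lia.
apply/fsetP => x; rewrite mem_interval; apply/imfsetP/idP => [[k /= kI ->]|xI].
  by rewrite st_rank_interval ?in_I //; rewrite mem_interval in kI; lia.
have xI' : (x + m)%N \in interval (m + sumn (take j s)) (nth 0%N s j).
  by rewrite mem_interval; lia.
by exists (x + m)%N; rewrite // st_rank_interval ?in_I // addnK.
Qed.

Lemma comp_blocks1 n (beta : composition n) :
  comp_blocks beta 1%g = interval_blocks 0 beta.
Proof.
apply: (eq_from_nth (x0 := fset0)) => [|j].
  by rewrite size_map size_iota size_interval_blocks.
rewrite size_map size_iota => jb.
rewrite (nth_map 0%N) ?size_iota // nth_iota // nth_interval_blocks // !add0n.
have tE : sumn (take j.+1 beta) = (sumn (take j beta) + nth 0 beta j)%N.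
  by rewrite (take_nth 0%N) // sumn_rcons.
have tn : (sumn (take j.+1 beta) <= n)%N.
  by rewrite -[in leqRHS](sumn_comp beta) -[in leqRHS](take_size beta) sumn_take_le.
apply/fsetP => x; rewrite mem_interval; apply/imfsetP/idP => [[k /= + ->]|xI].
  by rewrite inE perm1; lia.
have xn : (x.-1 < n)%N by lia.
by exists (Ordinal xn); rewrite /= ?inE ?perm1 /=; lia.
Qed.

Fact comp_of_seq_subproof s : 0%N \notin s -> (0%N \notin s) && (sumn s == sumn s).
Proof. by move=> ->; rewrite eqxx. Qed.

Definition comp_take n (beta : composition n) k : composition (sumn (take k beta)) :=
  Composition (comp_of_seq_subproof (notin_take k (comp_notin0 beta))).

Definition comp_drop n (beta : composition n) k : composition (sumn (drop k beta)) :=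
  Composition (comp_of_seq_subproof (notin_drop k (comp_notin0 beta))).

Lemma st_take n (beta : composition n) k :
  st (take_subproof (comp_setcomp beta 1%g) k) = comp_setcomp (comp_take beta k) 1%g.
Proof.
by apply: val_inj; rewrite /= !comp_blocks1 take_interval_blocks st_seq_interval.
Qed.

Lemma st_drop n (beta : composition n) k :
  st (drop_subproof (comp_setcomp beta 1%g) k) = comp_setcomp (comp_drop beta k) 1%g.
Proof.
by apply: val_inj; rewrite /= !comp_blocks1 drop_interval_blocks st_seq_interval.
Qed.

(** Equality is asked of the underlying lists because the two compositions may be typed by different
    expressions for the same integer. *)
Lemma comp_setcomp1_eq n n' (beta : composition n) (beta' : composition n') :
  beta = beta' :> seq nat -> comp_setcomp beta 1%g = comp_setcomp beta' 1%g.
Proof. by move=> e; apply: val_inj; rewrite /= !comp_blocks1 e. Qed.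

(** * The antipode on M_beta^Id and on the fundamental elements *)

Lemma convolution_Mbasis (R : comPzRingType) (S T : NCQSym R -> NCQSym R) A w :
  convolution S T (Mbasis R A) w =
  \sum_(k < (size A).+1)
     series_mul (to_series (S (Mbasis R (st (take_subproof A k)))))
                (to_series (T (Mbasis R (st (drop_subproof A k))))) w.
Proof.
rewrite /convolution /comul sum_msupp_sum.
under eq_bigr => B _.
  rewrite sum_msupp_sum; under eq_bigr do rewrite sum_msuppU; rewrite -mulr_sumr.
over.
by rewrite sum_msuppU mul1r.
Qed.

(** Only the empty word is constant on the blocks of the empty composition, so only the full prefix
    survives; this evaluates the top term of the convolution. *)
Lemma sum_split_nil (R : comPzRingType) (f : seq nat -> R) w :
  \sum_(m < (size w).+1) f (take m w) * (block_constant ltn [::] (drop m w))%:R = f w.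
Proof.
rewrite big_ord_recr /= take_size drop_size mulr1 big1 ?add0r // => m _.
rewrite /block_constant andbT -size_eq0 size_drop subn_eq0.
by rewrite leqNgt (ltn_ord m) mulr0.
Qed.

Lemma antipode_Mbasis (R : comPzRingType) (S : {linear NCQSym R -> NCQSym R})
    (antiS : is_antipode S) n (beta : composition n) w :
  to_series (S (Mbasis R (comp_setcomp beta 1%g))) w =
  (-1) ^+ size beta * (block_constant geq beta w)%:R.
Proof.
have [l] := ubnP (size beta); elim: l n beta w => // l IHl n beta w; rewrite ltnS => bl.
have [+ _] := antiS (Mbasis R (comp_setcomp beta 1%g)) w.
rewrite convolution_Mbasis.
have -> : size (comp_setcomp beta 1%g) = size beta by rewrite size_map size_iota.
have -> : counit (Mbasis R (comp_setcomp beta 1%g)) * series1 R w =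
          (((beta : seq nat) == [::]) && (w == [::]))%:R.
  rewrite /counit mcoeffU -mulnb natrM -val_eqE /= -size_eq0 size_map size_iota.
  by rewrite size_eq0.
(* With the co-unit written as an alternating sum, both sides are sums over [k] whose terms below
   [size beta] agree by induction. *)
rewrite -(alternating_block_constant R w (comp_notin0 beta)).
under eq_bigr => k _.
  rewrite /series_mul; under eq_bigr do
    rewrite st_take st_drop to_series_Mbasis Mseries_comp1 /=.
over.
rewrite big_ord_recr [X in _ = X -> _]big_ord_recr /=.
under eq_bigr => k _.
  under eq_bigr do rewrite IHl ?size_takel ?(leq_trans (ltn_ord k) bl) // 1?ltnW //.
over.
have -> : comp_setcomp (comp_take beta (size beta)) 1%g = comp_setcomp beta 1%g.
  by apply: comp_setcomp1_eq; rewrite /= take_size.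
(* Cancelling the common terms leaves [k = size beta], the only term that involves the antipode of
   the whole M_beta^Id. *)
move/addrI; rewrite drop_size take_size.
rewrite (sum_split_nil (to_series (S (Mbasis R (comp_setcomp beta 1%g))))).
by rewrite (sum_split_nil (fun u => (-1) ^+ size beta * (block_constant geq beta u)%:R)).
Qed.

Theorem theorem4p36 (R : comPzRingType) (S : {linear NCQSym R -> NCQSym R})
    (hS : is_antipode S) (n : nat) (alpha : composition n) :
  S (Fund R alpha 1%g) =
    (-1) ^+ n *: Fund R (comp_transpose alpha) (longest_perm n).
Proof.
apply: to_series_inj => w; rewrite linear_sum to_seriesZ !to_series_sum.
under eq_bigr do rewrite antipode_Mbasis //.
under [in RHS]eq_bigr do rewrite to_series_Mbasis Mseries_comp_longest.
exact: sum_block_constant_transpose.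
Qed.
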